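(* Fix $\lambda,\eta>0$ and $m>1$. Let $\Psi:\mathbb{R}^d\to[0,\infty)$ be in $W^{1,1}_{\mathrm{loc}}(\mathbb{R}^d)$ and satisfy: there are $R,\delta>0$ with $\Psi(y)\ge(\lambda(d+2)+\delta)\ln|y|$ for all $|y|\ge R$; and there is $K>0$ with $|\nabla\Psi(y)|\le K(1+|y|)$ for (almost) all $y\in\mathbb{R}^d$. Then $\rho_\infty:=U(\cdot;C^* )$ is the unique minimizer (up to $\mathcal{L}^d$-a.e. equality) of $$J_{\lambda,\eta}(\rho)=\int_{\mathbb{R}^d}\Big(\Psi(y)\rho(y)+\lambda\rho(y)\ln\rho(y)+\frac{\eta}{m-1}\rho(y)^m\Big)dy$$ over $\rho\in\mathcal{D}_2(\mathbb{R}^d)$.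
   Context: $\mathcal{L}^d$ is Lebesgue measure on $\mathbb{R}^d$; $\mathcal{D}_2(\mathbb{R}^d)$ is the set of probability density functions $\rho$ on $\mathbb{R}^d$ with $\int|y|^2\rho(y)\,dy<\infty$. With $H(s)=\lambda s\ln s$ for $s>0$, $H(0)=0$, the functional is understood as $J_{\lambda,\eta}(\rho)=\int\Psi\rho\,dy+\int H^+(\rho)\,dy-\int H^-(\rho)\,dy+\int\frac{\eta}{m-1}\rho^m\,dy\in(-\infty,\infty]$ ($H^-(\rho)$ is integrable for $\rho\in\mathcal{D}_2(\mathbb{R}^d)$). Let $h(z)=\lambda\ln z+\frac{\eta m}{m-1}(z^{m-1}-1)$, $z>0$, a strictly increasing bijection from $(0,\infty)$ onto $\mathbb{R}$, and $U(y;C)=h^{-1}(C-\Psi(y))>0$ for $y\in\mathbb{R}^d$, $C\in\mathbb{R}$. Since there are $R,\delta>0$ with $\Psi(y)\ge(\lambda(d+2)+\delta)\ln|y|$ for all $|y|\ge R$, there is a unique $C^*\in\mathbb{R}$ with $\int_{\mathbb{R}^d}U(y;C^* )\,dy=1$. *)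

(* Defs.v *)
From HB Require Import structures.
From mathcomp Require Import all_boot all_order all_algebra.
From mathcomp Require Import all_classical all_reals all_analysis.

Set Implicit Arguments.
Unset Strict Implicit.
Unset Printing Implicit Defensive.

Import Order.TTheory GRing.Theory Num.Theory.
Import numFieldNormedType.Exports.

Local Open Scope classical_set_scope.
Local Open Scope ring_scope.

(* Lebesgue measure on R^d: the Lebesgue outer measure, obtained from countable
   covers by half-open boxes, restricted to its Caratheodory-measurable sets.
   The covering families may be empty, so d = 0 is not degenerate. *)
Section lebesgue_outer.
Context {R : realType} (d : nat).
Implicit Types (a b : 'rV[R]_d) (p : 'rV[R]_d * 'rV[R]_d) (A : set 'rV[R]_d).

Definition box p : set 'rV[R]_d :=
  [set x | forall i, p.1 0 i < x 0 i <= p.2 0 i].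

Definition box_vol p : R := \prod_(i < d) Num.max 0 (p.2 0 i - p.1 0 i).

Definition box_cover A : set (set ('rV[R]_d * 'rV[R]_d)) :=
  [set D | countable D /\ A `<=` \bigcup_(p in D) box p].

Definition lebesgue_outer A : \bar R :=
  ereal_inf [set \esum_(p in D) (box_vol p)%:E | D in box_cover A].

Lemma box_vol_ge0 p : 0 <= box_vol p.
Proof. by apply: prodr_ge0 => i _; rewrite le_max lexx. Qed.

Local Open Scope ereal_scope.

Lemma lebesgue_outer_ge0 A : 0 <= lebesgue_outer A.
Proof.
apply: le_ereal_inf_tmp => _ [D _ <-].
by apply: esum_ge0 => p _; rewrite lee_fin box_vol_ge0.
Qed.

Lemma lebesgue_outer0 : lebesgue_outer set0 = 0.
Proof.
apply/eqP; rewrite eq_le lebesgue_outer_ge0 andbT.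
by apply: ereal_inf_lbound; exists set0; [split|rewrite esum_set0].
Qed.

Lemma le_lebesgue_outer :
  {homo lebesgue_outer : A B / A `<=` B >-> A <= B}.
Proof.
move=> A B AB; apply/ereal_inf_le_tmp => _ [D [cD BD] <-].
by exists D => //; split => //; exact: subset_trans BD.
Qed.

Lemma lebesgue_outer_sigma_subadditive : sigma_subadditive lebesgue_outer.
Proof.
move=> A; have [[i ioo]|] := pselect (exists i, lebesgue_outer (A i) = +oo).
  rewrite (eseries_pinfty _ _ ioo) ?leey// => n _.
  by rewrite -ltNye (lt_le_trans _ (lebesgue_outer_ge0 _)).
rewrite -forallNE => Aoo.
have v0 p : 0 <= (box_vol p)%:E by rewrite lee_fin box_vol_ge0.
suff add2e (e : {posnum R}) : lebesgue_outer (\bigcup_n A n) <=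
    \sum_(i <oo) lebesgue_outer (A i) + e%:num%:E.
  by apply/lee_addgt0Pr => _/posnumP[].
rewrite (le_trans _ (epsilon_trick _ _ _))//; last first.
  by move=> n; exact: lebesgue_outer_ge0.
pose P n D := box_cover (A n) D /\ \esum_(p in D) (box_vol p)%:E <=
  lebesgue_outer (A n) + (e%:num / (2 ^ n.+1)%:R)%:E.
have [G PG] : {G : nat -> set ('rV[R]_d * 'rV[R]_d) & forall n, P n (G n)}.
  apply: (@choice _ _ P) => n; rewrite /P.
  have fA : lebesgue_outer (A n) \is a fin_num.
    by rewrite ge0_fin_numE ?lebesgue_outer_ge0// ltey; apply/eqP/Aoo.
  have en1 : (0 < e%:num / (2 ^ n.+1)%:R)%R by [].
  have [_ [D cD <-] Dlt] := lb_ereal_inf_adherent en1 fA.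
  by exists D; split => //; exact/ltW.
pose D := \bigcup_n G n.
apply: (@le_trans _ _ (\esum_(p in D) (box_vol p)%:E)).
  apply: ereal_inf_lbound; exists D => //; split.
    by apply: bigcup_countable => // n _; have [[]] := PG n.
  move=> x [n _ /(PG n).1.2 [p Gp px]].
  by exists p => //; exists n.
apply: (@le_trans _ _ (\sum_(n <oo) \esum_(p in G n) (box_vol p)%:E)); last first.
  apply: lee_nneseries => [n _ _|n _]; first exact: esum_ge0.
  exact: (PG n).2.
rewrite nneseries_esumT; last by move=> n; exact: esum_ge0.
rewrite (@esum_esum _ _ _ _ G)//.
have [f fP] : {f : 'rV[R]_d * 'rV[R]_d -> nat & forall p, D p -> G (f p) p}.
  apply: (@choice _ _ (fun p n => D p -> G n p)) => p.
  by have [[n _ Gp]|nDp] := pselect (D p); [exists n|exists 0%N].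
pose g p := (f p, p).
have bg : set_bij D (g @` D) g.
  by split => // p q _ _ [].
rewrite -(@reindex_esum R _ _ D (g @` D) g (fun k => (box_vol k.2)%:E) bg).
rewrite esum_mkcond [leRHS]esum_mkcond; apply: le_esum => k _.
case: ifPn => [|_]; last by case: ifPn.
rewrite inE => -[p Dp <-].
by rewrite ifT// inE; split => //; exact: fP.
Qed.

HB.instance Definition _ := isOuterMeasure.Build R 'rV[R]_d lebesgue_outer
  lebesgue_outer0 lebesgue_outer_ge0 le_lebesgue_outer
  lebesgue_outer_sigma_subadditive.

End lebesgue_outer.

Notation lebesgue_rV_type R d := (caratheodory_type (@lebesgue_outer R d)).

Definition lebesgue_rV (R : realType) (d : nat) :
  set (lebesgue_rV_type R d) -> \bar R := @lebesgue_outer R d.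

HB.instance Definition _ (R : realType) (d : nat) :=
  isMeasure.Build _ _ _ (@lebesgue_rV R d)
    (@caratheodory_measure0 _ _ (@lebesgue_outer R d))
    (@caratheodory_measure_ge0 _ _ (@lebesgue_outer R d))
    (@caratheodory_measure_sigma_additive _ _ (@lebesgue_outer R d)).

(* The norm provided by the library on 'rV[R]_d is the sup norm. *)
Definition enorm {R : realType} (d : nat) (x : 'rV[R]_d) : R :=
  Num.sqrt (\sum_(i < d) x 0 i ^+ 2).

Section W11loc.
Context {R : realType} (d : nat).
Local Notation mu := (@lebesgue_rV R d).
Implicit Types (f g phi Psi : 'rV[R]_d -> R) (G : 'rV[R]_d -> 'rV[R]_d).

(* delta_mx 0 i is the i-th vector of the canonical basis. *)
Definition partial (i : 'I_d) f : 'rV[R]_d -> R := 'D_(delta_mx 0 i) f.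

Definition iter_partial (s : seq 'I_d) f : 'rV[R]_d -> R :=
  foldr partial f s.

(* C^infty: all partial derivatives of all orders exist and are continuous. *)
Definition smooth f : Prop := forall s : seq 'I_d,
  continuous (iter_partial s f) /\
  forall i x, derivable (iter_partial s f) x (delta_mx 0 i).

Definition test_function phi : Prop :=
  smooth phi /\ compact (closure [set x | phi x != 0]).

Definition loc_integrable f : Prop :=
  measurable_fun [set: lebesgue_rV_type R d] f /\
  forall A : set 'rV[R]_d, compact A ->
    (\int[mu]_(x in A) `|f x|%:E < +oo)%E.

(* g is the weak i-th partial derivative of f. *)
Definition weak_partial (i : 'I_d) f g : Prop := forall phi,
  test_function phi ->
  (\int[mu]_x (f x * partial i phi x)%:E = - \int[mu]_x (g x * phi x)%:E)%E.

Definition weak_gradient Psi G : Prop := forall i : 'I_d,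
  loc_integrable (fun x => G x 0 i) /\
  weak_partial i Psi (fun x => G x 0 i).

Definition W11loc Psi : Prop :=
  loc_integrable Psi /\ exists G, weak_gradient Psi G.

End W11loc.

Section functional.
Context {R : realType} (d : nat).
Local Notation mu := (@lebesgue_rV R d).
Implicit Types (lambda eta m C : R) (Psi rho : 'rV[R]_d -> R).

(* Densities are represented by everywhere nonnegative functions. *)
Definition D2 : set ('rV[R]_d -> R) := [set rho : 'rV[R]_d -> R |
  [/\ measurable_fun [set: lebesgue_rV_type R d] rho,
      forall y, 0 <= rho y,
      (\int[mu]_y (rho y)%:E = 1)%E &
      (\int[mu]_y (enorm y ^+ 2 * rho y)%:E < +oo)%E]].

Definition entropy lambda (s : R) : R :=
  if 0 < s then lambda * s * ln s else 0.

(* The negative part is integrable for rho in D2, so no oo - oo arises there. *)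
Definition Jfun lambda eta m Psi rho : \bar R :=
  (\int[mu]_y (Psi y * rho y)%:E
   + \int[mu]_y (Num.max (entropy lambda (rho y)) 0)%:E
   - \int[mu]_y (Num.max (- entropy lambda (rho y)) 0)%:E
   + \int[mu]_y (eta / (m - 1) * (rho y `^ m))%:E)%E.

Definition hfun lambda eta m (z : R) : R :=
  lambda * ln z + eta * m / (m - 1) * (z `^ (m - 1) - 1).

(* hfun is a bijection from ]0, +oo[ onto R when lambda, eta > 0 and m > 1, so
   the default value of xget is then never returned. *)
Definition hinv lambda eta m (t : R) : R :=
  xget 0 [set z | 0 < z /\ hfun lambda eta m z = t].

Definition Ufun lambda eta m Psi C (y : 'rV[R]_d) : R :=
  hinv lambda eta m (C - Psi y).

End functional.

Definition minimizer {R : realType} {T : Type} (J : T -> \bar R) (D : set T) :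
  set T := [set x | D x /\ forall y, D y -> (J x <= J y)%E].

(* Main.v *)
(* The energy density [entropy s + eta / (m - 1) * s ^ m] is strictly convex, and
   its derivative at [U y] is [C - Psi y] up to a constant.  In the tangent
   inequality at [U] the potential therefore cancels, what remains is a multiple
   of [rho - U], and this integrates to zero as both densities have mass one.
   Strictness gives uniqueness.

   The growth of [Psi] makes
   [exp (- Psi / lambda)], hence [U], decay like [|y| ^ - (d + 2 + a)], which is
   integrable against [|y| ^ 2] by a dyadic decomposition.  The constant [Cstar]
   comes from the intermediate value theorem: [ln \o hinv] is Lipschitz, so the
   logarithm of the mass of [U _ C] is Lipschitz in [C].  The lower bound on
   Lebesgue measure, needed for positivity of masses, is obtained by integrating
   the inequality between indicators of a box and of its cover one coordinate at
   a time. *)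
Require Import Defs.
From HB Require Import structures.
From mathcomp Require Import all_boot all_order all_algebra.
From mathcomp Require Import all_classical all_reals all_analysis.
From mathcomp Require Import measurable_realfun ring lra.

Set Implicit Arguments.
Unset Strict Implicit.
Unset Printing Implicit Defensive.

Import Order.TTheory GRing.Theory Num.Theory.
Import numFieldNormedType.Exports.

Local Open Scope classical_set_scope.
Local Open Scope ring_scope.

(** * The scalar function [hfun], its inverse and its growth *)

Section scalar_functions.
Context {R : realType} (lambda eta m : R).
Hypotheses (lambda_gt0 : 0 < lambda) (eta_gt0 : 0 < eta) (m_gt1 : 1 < m).
Implicit Types s t u z : R.

Local Notation h := (hfun lambda eta m).
Local Notation hinv := (hinv lambda eta m).
Local Notation k := (eta * m / (m - 1)).

Lemma hfun_coef_gt0 : 0 < k.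
Proof. by rewrite divr_gt0 ?subr_gt0// mulr_gt0// (lt_trans _ m_gt1). Qed.

Lemma lt_hfun z z' : 0 < z -> z < z' -> h z < h z'.
Proof.
move=> z0 zz'; have z'0 := lt_trans z0 zz'.
rewrite /hfun ltr_leD//; first by rewrite ltr_pM2l// ltr_ln.
rewrite ler_pM2l ?hfun_coef_gt0// lerD2r ge0_ler_powR ?nnegrE ?ltW//.
by rewrite subr_gt0.
Qed.

Lemma hfun_inj z z' : 0 < z -> 0 < z' -> h z = h z' -> z = z'.
Proof.
move=> z0 z'0 hh; apply/eqP; case: ltgtP => // /lt_hfun.
  by rewrite hh ltxx => /(_ z0).
by rewrite hh ltxx => /(_ z'0).
Qed.

(** In the exponential variable [hfun] becomes a linear function plus an exponential, visibly
    continuous. *)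
Lemma hfun_expR t :
  h (expR t) = lambda * t + k * (expR ((m - 1) * t) - 1).
Proof. by rewrite /hfun expRK /powR gt_eqF ?expR_gt0// expRK. Qed.

Lemma hfun_surj t : exists z, 0 < z /\ h z = t.
Proof.
have k0 := hfun_coef_gt0.
(* As [a <= 0], the exponential term at [a] is at most 0, so [lambda * a <= t] suffices there. At
   [b] this term is at least [- k], so [t + k <= lambda * b] suffices. *)
pose a := Num.min 0 (t / lambda); pose b := Num.max a ((t + k) / lambda).
have ab : a <= b by rewrite le_max lexx.
have cg : {within `[a, b], continuous (h \o expR)}.
  apply: continuous_subspaceT => x.
  rewrite (_ : h \o expR = fun t => lambda * t + k * (expR ((m - 1) * t) - 1));
    last by apply/funext => y /=; rewrite hfun_expR.
  apply: cvgD; first by apply: cvgM; [exact: cvg_cst|exact: cvg_id].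
  apply: cvgM; first exact: cvg_cst.
  apply: cvgB; last exact: cvg_cst.
  apply: continuous_comp; last exact: continuous_expR.
  by apply: cvgM; [exact: cvg_cst|exact: cvg_id].
have ha : h (expR a) <= t.
  rewrite hfun_expR -[leRHS]addr0 lerD//.
    by rewrite mulrC -ler_pdivlMr// ge_min lexx orbT.
  rewrite pmulr_rle0// subr_le0 -[leRHS]expR0 ler_expR.
  by rewrite pmulr_rle0 ?subr_gt0// ge_min lexx.
have hb : t <= h (expR b).
  rewrite hfun_expR; have : (t + k) / lambda <= b by rewrite le_max lexx orbT.
  rewrite ler_pdivrMr// => tkb.
  have : 0 <= k * expR ((m - 1) * b) by rewrite mulr_ge0 ?expR_ge0// ltW.
  by move: tkb; lra.
have min_le_max (x y : R) : x <= t -> t <= y -> Num.min x y <= t <= Num.max x y.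
  by move=> xt ty; rewrite ge_min le_max xt ty orbT.
have [|c _ /= hc] := @IVT _ (h \o expR) a b t ab cg.
  by apply: min_le_max.
by exists (expR c); rewrite expR_gt0.
Qed.

Lemma hinvP t : 0 < hinv t /\ h (hinv t) = t.
Proof.
rewrite /Defs.hinv; case: xgetP => [y _ []//|noz].
by have [z [z0 hz]] := hfun_surj t; case: (noz z).
Qed.

Lemma hinv_gt0 t : 0 < hinv t. Proof. by have [] := hinvP t. Qed.

Lemma hinvK t : h (hinv t) = t. Proof. by have [] := hinvP t. Qed.

Lemma hfunK z : 0 < z -> hinv (h z) = z.
Proof. by move=> z0; apply: hfun_inj (hinv_gt0 _) z0 (hinvK _). Qed.

Lemma hinv_le : {homo hinv : t t' / t <= t'}.
Proof.
move=> t t'; apply: contraTT; rewrite -!ltNge => /(lt_hfun (hinv_gt0 _)).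
by rewrite !hinvK.
Qed.

Lemma hinv_lt : {homo hinv : t t' / t < t'}.
Proof.
move=> t t' tt'; rewrite lt_neqAle hinv_le ?ltW// andbT.
by apply: contraTneq tt' => e; rewrite -(hinvK t) e hinvK ltxx.
Qed.

(* [ln \o hinv] is Lipschitz, because its inverse [h \o expR] has slope at
   least [lambda]. *)
Lemma hinv_le_expR t t' : t <= t' ->
  hinv t' <= hinv t * expR ((t' - t) / lambda).
Proof.
move=> tt'; have [z0 z'0] := (hinv_gt0 t, hinv_gt0 t').
rewrite -[hinv t']lnK ?posrE// -[hinv t in leRHS]lnK ?posrE//.
rewrite -expRD ler_expR -lerBlDl ler_pdivlMr// mulrC mulrBr.
rewrite -{2}(hinvK t) -{2}(hinvK t') /hfun.
suff : k * hinv t `^ (m - 1) <= k * hinv t' `^ (m - 1).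
  by set x := k * _; set y := k * _ => xy; rewrite !mulrBr -/x -/y; lra.
rewrite ler_pM2l ?hfun_coef_gt0//.
by rewrite ge0_ler_powR ?nnegrE ?hinv_le ?(ltW z0) ?(ltW z'0)// subr_ge0 ltW.
Qed.

(** Dropping the nonnegative power term from [h z = t] leaves [lambda * ln z <= t + k]. *)
Lemma hinv_ub t : hinv t <= expR ((t + k) / lambda).
Proof.
rewrite -[hinv t]lnK ?posrE ?hinv_gt0// ler_expR ler_pdivlMr//.
rewrite -{2}(hinvK t) /hfun mulrC mulrBr mulr1 -addrA subrK lerDl.
by rewrite mulr_ge0 ?powR_ge0// ltW// hfun_coef_gt0.
Qed.

(** * Tangent inequalities for the energy *)

Definition energy s : R := entropy lambda s + eta / (m - 1) * s `^ m.

(** For [s > 0] this is [ln x < x - 1] at [x = u / s], multiplied by [lambda * s]. For [s = 0] it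
    reads [- lambda * u < 0]. *)
Lemma entropy_tangent s u : 0 <= s -> 0 < u -> s != u ->
  entropy lambda u + lambda * (ln u + 1) * (s - u) < entropy lambda s.
Proof.
move=> s0 u0 su; rewrite /entropy u0.
have [{}s0|] := ltrP 0 s; last first.
  move=> s0'; have -> : s = 0 by apply/eqP; rewrite eq_le s0 s0'.
  by have := mulr_gt0 lambda_gt0 u0; rewrite /=; set l := ln u; lra.
have us0 : 0 < u / s by rewrite divr_gt0.
have : ln (u / s) < u / s - 1.
  have us1 : u / s - 1 != 0 by rewrite subr_eq0; apply: contra su => /eqP/divr1_eq ->.
  by have := expR_gt1Dx us1; rewrite -ltr_expR lnK ?posrE// addrC subrK.
rewrite ln_div ?posrE// => lus.
have : s * (ln u - ln s) < s * (u / s - 1) by rewrite ltr_pM2l.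
have -> : s * (u / s - 1) = u - s by field; rewrite gt_eqF.
by rewrite -(ltr_pM2l lambda_gt0); set l := ln u; set l' := ln s; lra.
Qed.

(* Young's inequality for [s] and [u `^ (m - 1)] *)
Lemma powR_tangent s u : 0 <= s -> 0 < u ->
  u `^ m + m * u `^ (m - 1) * (s - u) <= s `^ m.
Proof.
move=> s0 u0; have m0 : 0 < m by rewrite (lt_trans _ m_gt1).
have m1 : 0 < m - 1 by rewrite subr_gt0.
have uu : u `^ (m - 1) * u = u `^ m.
  by rewrite -[X in _ * X](powRr1 (ltW u0)) -powRD ?subrK// gt_eqF ?implybT.
have /= := @conjugate_powR _ s (u `^ (m - 1)) m (m / (m - 1)) s0 (powR_ge0 _ _) m0.
rewrite divr_gt0// -powRrM [_ * (m / _)]mulrCA divff ?gt_eqF// mulr1.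
move=> /(_ isT) /(_ _)/wrap[].
  by rewrite invf_div -[X in X + _]mul1r -mulrDl addrC subrK divff ?gt_eqF.
rewrite invf_div -(ler_pM2l m0) => young.
have : m * (s `^ m / m + u `^ m * ((m - 1) / m)) = s `^ m + (m - 1) * u `^ m.
  by field; rewrite gt_eqF.
by move: young uu; nra.
Qed.

(** The slope [h u + lambda + k] is the derivative of [energy] at [u]. Strictness is inherited from
    the entropy. *)
Lemma energy_tangent s u : 0 <= s -> 0 < u -> s != u ->
  energy u + (h u + lambda + k) * (s - u) < energy s.
Proof.
move=> s0 u0 su; have eta' : 0 < eta / (m - 1) by rewrite divr_gt0 ?subr_gt0.
have := entropy_tangent s0 u0 su; have := powR_tangent s0 u0.
rewrite -(ler_pM2l eta') /energy /hfun => pow ent.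
apply: le_lt_trans (ltr_leD ent pow); rewrite le_eqVlt; apply/orP; left.
by apply/eqP; ring.
Qed.

(** With [z = hinv t], the increment [h (T * z) - h z] is [lambda * ln T + k * z ^ (m - 1) * (T ^ (m
    - 1) - 1)]. It is bounded uniformly in [t <= t0], because [z] then stays below [b]. *)
Lemma hinv_scale T t0 : 1 <= T -> exists D : R, forall t, t <= t0 ->
  T * hinv t <= hinv (t + D).
Proof.
move=> T1; have T0 : 0 < T by rewrite (lt_le_trans _ T1).
pose b := expR ((t0 + k) / lambda).
exists (lambda * ln T + k * (b `^ (m - 1) * (T `^ (m - 1) - 1))) => t tt0.
have z0 : 0 < hinv t by exact: hinv_gt0.
have k0 : 0 < k by exact: hfun_coef_gt0.
rewrite -[T * _]hfunK ?mulr_gt0//.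
apply: hinv_le; rewrite -{2}(hinvK t) /hfun.
rewrite lnM ?posrE// powRM ?(ltW T0) ?(ltW z0)//.
have zb : hinv t `^ (m - 1) <= b `^ (m - 1).
  rewrite ge0_ler_powR ?nnegrE ?subr_ge0 ?(ltW m_gt1) ?(ltW z0) ?expR_ge0//.
  apply: le_trans (hinv_ub t) _.
  by rewrite ler_expR ler_pM2r ?invr_gt0// lerD2r.
have T1' : 1 <= T `^ (m - 1).
  rewrite /powR gt_eqF// -[leLHS]expR0 ler_expR.
  by rewrite mulr_ge0 ?ln_ge0// subr_ge0 ltW.
have : 0 <= (T `^ (m - 1) - 1) * (b `^ (m - 1) - hinv t `^ (m - 1)).
  by rewrite mulr_ge0// subr_ge0.
rewrite -(pmulr_rge0 _ k0).
move: (T `^ _) (b `^ _) (hinv t `^ _) (ln T) (ln _) => x1 x2 x3 x4 x5.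
by lra.
Qed.

(** The library sets [ln] to 0 on nonpositive numbers, which absorbs the case distinction. *)
Lemma entropyE s : entropy lambda s = lambda * s * ln s.
Proof.
by rewrite /entropy; case: ltP => // s0; rewrite ln0// mulr0.
Qed.

(** The tangent at [u] equals [lambda * (s * ln u + s - u)], from which the nonnegative [lambda * s]
    is dropped. *)
Lemma entropy_ge s u : 0 <= s -> 0 < u ->
  lambda * (s * ln u - u) <= entropy lambda s.
Proof.
move=> s0 u0; have ls0 : 0 <= lambda * s by rewrite mulr_ge0// ltW.
have [->|su] := eqVneq s u.
  rewrite entropyE -mulrA ler_pM2l// gerBl; exact: ltW.
have := ltW (entropy_tangent s0 u0 su); apply: le_trans.
by rewrite entropyE; move: ls0; move: (ln u) => l; lra.
Qed.

Lemma measurable_entropy : measurable_fun [set: R] (entropy lambda).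
Proof.
rewrite (funext entropyE); apply: measurable_funM; last exact: measurable_ln.
by apply: measurable_funM; [exact: measurable_cst|exact: measurable_id].
Qed.

Lemma measurable_hinv : measurable_fun [set: R] hinv.
Proof. by apply: nondecreasing_measurable => //; exact: hinv_le. Qed.

End scalar_functions.

(** * Lebesgue outer measure of boxes *)

Section lebesgue_outer_boxes.
Context {R : realType} (d : nat).
Hypothesis d_gt0 : (0 < d)%N.
Local Notation V := 'rV[R]_d.
Implicit Types (p : V * V) (A X : set V) (c : R) (i : 'I_d).

Let vol p : \bar R := (box_vol p)%:E.

Lemma box_vol_degenerate p i : (p.2 0 i <= p.1 0 i) -> box_vol p = 0.
Proof.
move=> pi; rewrite /box_vol (bigD1 i)//= (_ : Num.max _ _ = 0) ?mul0r//.
by apply/max_idPl; rewrite subr_le0.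
Qed.

(* A countable family is padded into a sequence with the degenerate box (0, 0),
   which has volume 0 since [0 < d]. *)
Lemma box_cover_seq A D : box_cover A D -> exists q : nat -> V * V,
  A `<=` \bigcup_n box (q n) /\ (\sum_(n <oo) vol (q n) = \esum_(p in D) vol p)%E.
Proof.
move=> [/countable_bijP[B]]; rewrite card_eq_sym => /pcard_eqP[f] AD.
exists (fun n => if n \in B then f n else (0, 0)); split.
  move=> x /AD[p Dp px].
  have [n Bn fn] : (f @` B) p by rewrite (image_eq f).
  by exists n => //; rewrite mem_set// fn.
rewrite (reindex_esum B D f); last exact: bij.
rewrite nneseries_esumT; last first.
  by move=> n; rewrite lee_fin box_vol_ge0.
rewrite [RHS]esum_mkcond; apply: eq_esum => n _; case: ifPn => // _.
by rewrite /vol (@box_vol_degenerate _ (Ordinal d_gt0))//= !mxE.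
Qed.

Lemma lebesgue_outer_box_le p : (lebesgue_outer (box p) <= vol p)%E.
Proof.
apply: ereal_inf_lbound; exists [set p].
  by split; [exact: countable1|move=> x px; exists p].
by rewrite esum_set1// lee_fin box_vol_ge0.
Qed.

Lemma lebesgue_outer_seq_le A (q : nat -> V * V) :
  A `<=` \bigcup_n box (q n) -> (lebesgue_outer A <= \sum_(n <oo) vol (q n))%E.
Proof.
move=> Aq; apply: le_trans (le_lebesgue_outer Aq) _.
apply: le_trans (lebesgue_outer_sigma_subadditive _) _.
apply: lee_nneseries => [n _ _|n _]; first exact: lebesgue_outer_ge0.
exact: lebesgue_outer_box_le.
Qed.

(** * Cutting boxes by coordinate hyperplanes, and measurability *)

Definition set_coord i c (x : V) : V :=
  \row_j (if j == i then c else x 0 j).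

Definition box_above i c p := (set_coord i (Num.max (p.1 0 i) c) p.1, p.2).

Definition box_below i c p := (p.1, set_coord i (Num.min (p.2 0 i) c) p.2).

Lemma box_aboveE i c p :
  box (box_above i c p) = box p `&` [set x | (c < x 0 i)].
Proof.
apply/seteqP; split=> [x xp|x [xp /= cx] j] /=.
  have := xp i; rewrite !mxE eqxx gt_max => /andP[/andP[_ ->] _]; split=> // j.
  by have := xp j; rewrite mxE; case: eqP => // ->; rewrite gt_max -andbA => /and3P[-> _ ->].
by rewrite mxE; case: eqP => [->|_]; rewrite ?gt_max ?cx ?andbT xp.
Qed.

Lemma box_belowE i c p :
  box (box_below i c p) = box p `&` ~` [set x | (c < x 0 i)].
Proof.
apply/seteqP; split=> [x xp|x [xp /= /negP]] /=.
  split=> [j|].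
    by have := xp j; rewrite mxE; case: eqP => // ->; rewrite le_min => /and3P[-> -> _].
  by have := xp i; rewrite !mxE eqxx le_min => /and3P[_ _] + ; rewrite leNgt => /negP.
rewrite -leNgt => xc j.
by rewrite mxE; case: eqP => [->|_]; rewrite ?le_min ?xc ?andbT xp.
Qed.

Lemma box_volD i c p :
  (box_vol (box_above i c p) + box_vol (box_below i c p) = box_vol p).
Proof.
rewrite /box_vol !(bigD1 (P := predT) i)//= !mxE eqxx.
under eq_bigr => j ji do rewrite mxE (negbTE ji).
under [X in (_ + _ * X)]eq_bigr => j ji do rewrite mxE (negbTE ji).
(* Only the [i]-th factor changes. It remains to split the length of an interval at [c], where
   either piece may be empty. *)
rewrite -mulrDl; congr (_ * _).
move: (p.1 0 i) (p.2 0 i) => a b.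
by case: (leP a c) (leP b c) => ac [] bc; rewrite !maxEle; do ![case: ifPn];
  rewrite -?ltNge => *; lra.
Qed.

(** For the Caratheodory criterion, the hyperplane cuts every cover of [X] into covers of the two
    parts of [X], without changing the total volume. *)
Lemma measurable_halfspace i c :
  measurable ([set x | (c < x 0 i)] : set (lebesgue_rV_type R d)).
Proof.
apply: le_caratheodory_measurable => X.
apply: le_ereal_inf_tmp => _ [D /box_cover_seq[q [Xq <-]] <-].
have -> : (\sum_(n <oo) vol (q n) = \sum_(n <oo) vol (box_above i c (q n)) +
    \sum_(n <oo) vol (box_below i c (q n)))%E.
  rewrite -nneseriesD => [|n _ _|n _ _]; rewrite ?lee_fin ?box_vol_ge0//.
  by apply: eq_eseriesr => n _; rewrite -EFinD box_volD.
by apply: leeD; apply: lebesgue_outer_seq_le => x [/Xq[n _ qx] cx]; exists n;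
  rewrite // ?box_aboveE ?box_belowE.
Qed.

Lemma measurable_coord i :
  measurable_fun [set: lebesgue_rV_type R d] (fun x : V => x 0 i).
Proof.
apply: (measurability (@RGenOInfty.G R)) => [|/= _ [_] [r] -> <-].
  exact: RGenOInfty.measurableE.
rewrite setTI (_ : _ @^-1` _ = [set x : V | (r < x 0 i)]).
  exact: measurable_halfspace.
by apply/seteqP; split=> x /=; rewrite in_itv/= andbT.
Qed.

Lemma measurable_enorm :
  measurable_fun [set: lebesgue_rV_type R d] (@enorm R d).
Proof.
have msqrt : measurable_fun [set: R] (@Num.sqrt R).
  by apply: nondecreasing_measurable => // s t; exact: ler_wsqrtr.
apply: (measurableT_comp msqrt); apply: measurable_sum => i.
exact/measurable_funX/measurable_coord.
Qed.

(* Coordinates below [k] are integrated out: [hybrid 0] is the indicator of the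
   box and [hybrid d] its volume. *)
Let hybrid (k : nat) p (x : V) : R := \prod_(i < d)
  (if (i < k)%N then Num.max 0 (p.2 0 i - p.1 0 i)
   else \1_(`]p.1 0 i, p.2 0 i]%classic : set R) (x 0 i)).

Let hybrid_ge0 k p x : 0 <= hybrid k p x.
Proof. by apply: prodr_ge0 => i _; case: ifP => _; rewrite ?le_max ?lexx. Qed.

Let hybrid0 p x : hybrid 0 p x = \1_(box p) x.
Proof.
rewrite indicE; case: (boolP (x \in box p)) => [|/negP xp].
  rewrite inE => xp; apply: big1 => i _ /=.
  by rewrite indicE mem_set//= in_itv/= xp.
apply/eqP/prodf_eq0; apply: contrapT => nz; apply: xp; rewrite inE => i /=.
apply: contrapT => /negP xi; apply: nz; exists i => //=.
by rewrite indicE memNset//= in_itv/=; exact/negP.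
Qed.

Let hybrid_last p x : hybrid d p x = box_vol p.
Proof. by apply: eq_bigr => i _; rewrite ltn_ord. Qed.

(** The constant [c] is the product of the factors other than the [k]-th. These do not see [t] and
    are the same in [hybrid k] and [hybrid k.+1]. *)
Let hybrid_coord k (kd : (k < d)%N) p x (i := Ordinal kd) :
  exists2 c : R, 0 <= c &
    (forall t, hybrid k p (set_coord i t x) =
      c * \1_(`]p.1 0 i, p.2 0 i]%classic : set R) t) /\
    hybrid k.+1 p x = c * Num.max 0 (p.2 0 i - p.1 0 i).
Proof.
exists (\prod_(j < d | j != i) (if (j < k)%N then Num.max 0 (p.2 0 j - p.1 0 j)
   else \1_(`]p.1 0 j, p.2 0 j]%classic : set R) (x 0 j))).
  by apply: prodr_ge0 => j _; case: ifP => _; rewrite ?le_max ?lexx.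
split=> [t|]; rewrite /hybrid (bigD1 i)//= ?ltnn ?ltnSn ?mxE ?eqxx mulrC.
  by congr (_ * _); apply: eq_bigr => j ji; rewrite mxE (negbTE ji).
congr (_ * _); apply: eq_bigr => j ji; rewrite ltnS leq_eqVlt.
by rewrite -val_eqE /= in ji; rewrite (negbTE ji).
Qed.

Let measurable_hybrid k (kd : (k < d)%N) p x :
  measurable_fun [set: measurableTypeR R]
    (fun t => (hybrid k p (set_coord (Ordinal kd) t x))%:E).
Proof.
have [c _ [hk _]] := hybrid_coord kd p x; apply/measurable_EFinP.
rewrite (funext hk); apply: measurable_funM; first exact: measurable_cst.
exact: measurable_indic.
Qed.

Let hybrid_step k (kd : (k < d)%N) p x :
  (\int[lebesgue_measure]_t (hybrid k p (set_coord (Ordinal kd) t x))%:E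
   = (hybrid k.+1 p x)%:E)%E.
Proof.
have [c c0 [hk ->]] := hybrid_coord kd p x.
under eq_integral do rewrite hk EFinM.
rewrite ge0_integralZl ?lee_fin//; last first.
  by apply/measurable_EFinP; exact: measurable_indic.
rewrite integral_indic// setIT EFinM; congr (_ * _)%E.
rewrite [LHS]lebesgue_measure_itv/= lte_fin -EFinD.
case: ifPn => [pi|]; first by rewrite max_r// subr_ge0 (ltW pi).
by rewrite -leNgt => pi; rewrite max_l// subr_le0.
Qed.

(** Induction on the number of integrated coordinates. It starts from the indicator of a box being
    at most the sum of those of its cover; each step integrates in one variable, exchanging sum and
    integral since all terms are nonnegative. *)
Lemma box_vol_le_lebesgue_outer p : (vol p <= lebesgue_outer (box p))%E.
Proof.
apply: le_ereal_inf_tmp => _ [D /box_cover_seq[q [pq <-]] <-].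
suff hyb k : (k <= d)%N -> forall x,
    ((hybrid k p x)%:E <= \sum_(n <oo) (hybrid k (q n) x)%:E)%E.
  have := hyb d (leqnn d) 0; rewrite hybrid_last.
  by under eq_eseriesr do rewrite hybrid_last.
elim: k => [_ x|k IH kd x].
  rewrite hybrid0 indicE; case: (boolP (x \in box p)) => [|_]; last first.
    by apply: nneseries_ge0 => n _ _; rewrite lee_fin.
  rewrite inE => /pq[n _ qx].
  apply: le_trans (nneseries_lim_ge n.+1 _); last first.
    by move=> j _ _; rewrite lee_fin.
  rewrite big_nat_recr//= hybrid0 indicE mem_set//= leeDr//.
  by apply: sume_ge0 => j _; rewrite lee_fin.
rewrite -(hybrid_step kd).
under eq_eseriesr do rewrite -(hybrid_step kd).
have h0 n t : (0 <= (hybrid k (q n) (set_coord (Ordinal kd) t x))%:E)%E.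
  by rewrite lee_fin.
rewrite -integral_nneseries//; apply: ge0_le_integral => //.
- by move=> t _; rewrite lee_fin.
- exact: ge0_emeasurable_sum.
- by move=> t _; apply: IH; exact: ltnW.
Qed.

Lemma lebesgue_rV_gt0 : (0 < @lebesgue_rV R d setT)%E.
Proof.
apply: (@lt_le_trans _ _ (vol (const_mx 0, const_mx 1))).
  rewrite lte_fin; apply: prodr_gt0 => i _; rewrite !mxE subr0.
  by rewrite lt_max ltr01 orbT.
apply: le_trans (box_vol_le_lebesgue_outer _) _.
exact: le_lebesgue_outer.
Qed.
End lebesgue_outer_boxes.

(** * Integrability from polynomial decay *)

Section polynomial_decay.
Context {R : realType} (d : nat).
Hypothesis d_gt0 : (0 < d)%N.
Local Notation V := 'rV[R]_d.
Local Notation mu := (@lebesgue_rV R d).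

Lemma enorm_ge0 (y : V) : 0 <= enorm y. Proof. exact: sqrtr_ge0. Qed.

Lemma enorm_coord_le (y : V) (i : 'I_d) : `|y 0 i| <= enorm y.
Proof.
rewrite -sqrtr_sqr ler_wsqrtr// (bigD1 i)//= lerDl.
by apply: sumr_ge0 => j _; exact: sqr_ge0.
Qed.

Lemma lebesgue_outer_ball_le (c : R) : 0 < c ->
  (lebesgue_outer [set y : V | (enorm y < c)%R] <= ((2 * c) ^+ d)%:E)%E.
Proof.
move=> c0; pose p : V * V := (const_mx (- c), const_mx c).
have -> : (2 * c) ^+ d = box_vol p.
  rewrite /box_vol (eq_bigr (fun=> 2 * c)) ?prodr_const ?card_ord// => i _.
  rewrite !mxE max_r; first by ring.
  by rewrite opprK addr_ge0// ltW.
apply: le_trans (lebesgue_outer_box_le p); apply: le_lebesgue_outer.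
move=> y /= yc i; rewrite !mxE.
have := le_lt_trans (enorm_coord_le y i) yc.
by rewrite ltr_norml => /andP[-> /ltW].
Qed.

Lemma measurable_ball_enorm (c : R) :
  measurable ([set y | enorm y < c] : set (lebesgue_rV_type R d)).
Proof.
have := @measurable_enorm R d d_gt0 measurableT _ (measurable_itv `]-oo, c[).
rewrite setTI (_ : _ @^-1` _ = [set y : V | enorm y < c])//.
Qed.

Lemma nneseries_geometric_lty (b r : R) : 0 <= b -> 0 <= r < 1 ->
  (\sum_(n <oo) (b * r ^+ n)%:E < +oo)%E.
Proof.
move=> b0 /andP[r0 r1].
apply: (@le_lt_trans _ _ (b / (1 - r))%:E); last exact: ltry.
apply: lime_le.
  by apply: is_cvg_nneseries => n _ _; rewrite lee_fin mulr_ge0// exprn_ge0.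
apply: nearW => n; rewrite sumEFin lee_fin -mulr_sumr ler_wpM2l//.
rewrite -[leRHS]mul1r ler_pdivlMr ?subr_gt0// mulrC.
by rewrite big_mkord -opprB mulNr -subrX1 opprB gerBl exprn_ge0.
Qed.

(** With [q = 2 ^ (- s)], [f] is dominated by [M / q] times the sum over [k] of [q ^ k] on the ball
    of radius [2 ^ k]. Such a ball has measure at most [(2 * 2 ^ k) ^ d], so the integrals are
    bounded by a geometric series of ratio [q * 2 ^ d = 2 ^ (- a)]. *)
Lemma integrable_polynomial_decay (f : V -> R) (M a : R) : 0 < a ->
  measurable_fun [set: lebesgue_rV_type R d] f ->
  (forall y, 0 <= f y) -> (forall y, f y <= M) ->
  (forall y, f y * enorm y `^ (d%:R + a) <= M) ->
  mu.-integrable setT (EFin \o f).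
Proof.
move=> a0 mf f0 fM fdecay; have M0 : 0 <= M := le_trans (f0 0) (fM 0).
pose s : R := d%:R + a; have s0 : 0 < s by rewrite ltr_wpDl.
have gt1 (b : R) : 0 < b -> 1 < 2 `^ b.
  move=> /gt0_ltr_powR/(_ 1 2); rewrite powR1.
  by apply; rewrite ?nnegrE ?ltr1n.
pose q : R := 2 `^ (- s); have q0 : 0 < q by exact: powR_gt0.
have q1 : q < 1 by rewrite /q powRN invf_lt1 ?powR_gt0// gt1.
pose B k := [set y : V | enorm y < 2 ^+ k].
pose w k y : \bar R := (q ^+ k * \1_(B k) y)%:E.
have w0 k y : (0 <= w k y)%E by rewrite lee_fin mulr_ge0// exprn_ge0// ltW.
have mw k : measurable_fun [set: lebesgue_rV_type R d] (w k).
  apply/measurable_EFinP; apply: measurable_funM; first exact: measurable_cst.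
  by apply: measurable_indic; exact: measurable_ball_enorm.
pose W y := (\sum_(k <oo) w k y)%E.
have W0 y : (0 <= W y)%E by apply: nneseries_ge0.
have mW : measurable_fun [set: lebesgue_rV_type R d] W.
  exact: ge0_emeasurable_sum.
have fW y : ((f y)%:E <= (M / q)%:E * W y)%E.
  have ex_k : exists k, enorm y < 2 ^+ k.
    exists (Num.bound (enorm y)); apply: lt_trans (archi_boundP (enorm_ge0 y)) _.
    by rewrite -natrX ltr_nat ltn_expl.
  (* The term of the smallest ball containing [y] suffices. If [k = 0], the bound [M] is used; if
     [k = j + 1], minimality gives [2 ^ j <= |y|], and the decay yields [f y <= M * q ^ j]. *)
  case: (ex_minnP ex_k) => k yk kmin.
  apply: (@le_trans _ _ ((M / q)%:E * w k y)%E); last first.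
    rewrite lee_wpmul2l ?lee_fin ?divr_ge0// ?(ltW q0)//.
    apply: le_trans (nneseries_lim_ge k.+1 _); last by move=> *; exact: w0.
    by rewrite big_nat_recr//= leeDr// sume_ge0.
  rewrite /w indicE mem_set//= mulr1 -EFinM lee_fin.
  case: k yk kmin => [|j] _ kmin.
    by rewrite expr0 mulr1 (le_trans (fM y))// ler_pdivlMr// ler_piMr// ltW.
  rewrite exprS mulrA divfK ?gt_eqF//.
  have yj : 2 ^+ j <= enorm y.
    by rewrite leNgt; apply/negP => /kmin; rewrite ltnn.
  have qj : q ^+ j = ((2 ^+ j) `^ s)^-1.
    by rewrite -powR_mulrn ?(ltW q0)// -powRrM mulrC powRrM powR_mulrn// powRN.
  rewrite qj ler_pdivlMr ?powR_gt0 ?exprn_gt0//.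
  apply: le_trans (fdecay y); rewrite ler_wpM2l//.
  by rewrite ge0_ler_powR ?nnegrE ?exprn_ge0 ?enorm_ge0// ltW.
apply/integrableP; split; first exact/measurable_EFinP.
apply: (@le_lt_trans _ _ (\int[mu]_y ((M / q)%:E * W y))%E).
  apply: ge0_le_integral; first exact: measurableT.
  - by move=> y _; exact: abse_ge0.
  - by apply: measurableT_comp; [exact: abse_measurable|exact/measurable_EFinP].
  - exact: measurable_funeM.
  - by move=> y _; rewrite /= ger0_norm.
rewrite ge0_integralZl//; last by rewrite lee_fin divr_ge0// ltW.
rewrite lte_mul_pinfty// ?lee_fin ?divr_ge0 ?(ltW q0)//.
rewrite integral_nneseries//.
have r01 : 0 <= q * 2 ^+ d < 1.
  rewrite mulr_ge0 ?(ltW q0) ?exprn_ge0//= -powR_mulrn// -powRD; last first.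
    by rewrite pnatr_eq0 implybT.
  by rewrite /s opprD addrAC addNr add0r powRN invf_lt1 ?powR_gt0// gt1.
apply: le_lt_trans (nneseries_geometric_lty (exprn_ge0 d (ler0n R 2)) r01).
apply: lee_nneseries => [k _ _|k _]; first exact: integral_ge0.
under eq_integral do rewrite /w EFinM.
rewrite ge0_integralZl; first last.
- by rewrite lee_fin exprn_ge0// ltW.
- by move=> y _; rewrite lee_fin.
- by apply/measurable_EFinP; apply: measurable_indic; exact: measurable_ball_enorm.
- exact: measurableT.
rewrite integral_indic ?setIT//; last exact: measurable_ball_enorm.
apply: (@le_trans _ _ ((q ^+ k)%:E * ((2 * 2 ^+ k) ^+ d)%:E)%E).
  rewrite lee_wpmul2l ?lee_fin ?exprn_ge0 ?(ltW q0)//.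
  exact: lebesgue_outer_ball_le.
by rewrite -EFinM lee_fin !exprMn -!exprM mulnC mulrCA.
Qed.
End polynomial_decay.

(** * Integrals of real-valued functions over a general measure *)

Section integrable_real_functions.
Context {R : realType} {disp : measure_display} {T : measurableType disp}
  (mu : {measure set T -> \bar R}).
Implicit Types (c : R) (f g : T -> R).

Lemma le_integrable_real f g : measurable_fun [set: T] f ->
  (forall y, `|f y| <= g y) -> mu.-integrable setT (EFin \o g) ->
  mu.-integrable setT (EFin \o f).
Proof.
move=> mf fg ig; apply: le_integrable ig; first exact: measurableT.
  exact/measurable_EFinP.
by move=> y _ /=; rewrite lee_fin (le_trans (fg y))// ler_norm.
Qed.

Lemma integrable_scale c f : mu.-integrable setT (EFin \o f) ->
  mu.-integrable setT (EFin \o (fun y => c * f y)).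
Proof. by move=> intf; exact: (integrableZl measurableT c intf). Qed.

Lemma integrable_add f g : mu.-integrable setT (EFin \o f) ->
  mu.-integrable setT (EFin \o g) ->
  mu.-integrable setT (EFin \o (fun y => f y + g y)).
Proof. by move=> intf intg; exact: (integrableD measurableT intf intg). Qed.

Lemma Rintegral_ae0 f : mu.-integrable setT (EFin \o f) ->
  (forall y, 0 <= f y) -> \int[mu]_y f y <= 0 ->
  {ae mu, forall y, f y = 0}.
Proof.
move=> intf f0 If.
have mf : measurable_fun [set: T] (EFin \o f).
  by case/integrableP : intf.
have : (\int[mu]_y `|(EFin \o f) y| = 0)%E.
  under eq_integral do rewrite /= ger0_norm//.
  apply/eqP; rewrite eq_le; apply/andP; split.
    by rewrite -(fineK (integrable_fin_num measurableT intf)) lee_fin.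
  by apply: integral_ge0 => y _; rewrite lee_fin.
move=> /(ae_eq_integral_abs mu measurableT mf); apply: filterS => y /(_ I) /=.
by case.
Qed.

(** Otherwise [f] vanishes almost everywhere, and the exceptional null set is the whole space. *)
Lemma Rintegral_gt0 f : (0 < mu setT)%E -> mu.-integrable setT (EFin \o f) ->
  (forall y, 0 < f y) -> 0 < \int[mu]_y f y.
Proof.
move=> mu_gt0 intf f0; rewrite ltNge; apply/negP => If0.
have [N [mN N0 fN]] := Rintegral_ae0 intf (fun y => ltW (f0 y)) If0.
move: mu_gt0; rewrite (_ : setT = N) ?N0 ?ltxx//; apply/seteqP.
by split=> // y _; apply: fN => /= fy; have := f0 y; rewrite fy ltxx.
Qed.

Lemma integrable_lty f : measurable_fun [set: T] f ->
  (forall y, 0 <= f y) -> (\int[mu]_y (f y)%:E < +oo)%E ->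
  mu.-integrable setT (EFin \o f).
Proof.
move=> mf f0 If; apply/integrableP; split; first exact/measurable_EFinP.
by under eq_integral do rewrite /= ger0_norm//.
Qed.

Lemma integral_lty f : mu.-integrable setT (EFin \o f) ->
  (\int[mu]_y (f y)%:E < +oo)%E.
Proof.
by move=> intf; rewrite -(fineK (integrable_fin_num measurableT intf)) ltry.
Qed.

End integrable_real_functions.

(** * The densities [U C]: domination and moments *)

Section stationary_density.
Context {R : realType} (d : nat) (lambda eta m : R) (Psi : 'rV[R]_d -> R).
Hypotheses (d_gt0 : (0 < d)%N) (lambda_gt0 : 0 < lambda) (eta_gt0 : 0 < eta)
  (m_gt1 : 1 < m) (Psi_ge0 : forall y, 0 <= Psi y)
  (measurable_Psi : measurable_fun [set: lebesgue_rV_type R d] Psi)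
  (Psi_growth : exists r delta : R, [/\ 0 < r, 0 < delta &
     forall y : 'rV[R]_d, r <= enorm y ->
       (lambda * (d%:R + 2) + delta) * ln (enorm y) <= Psi y]).
Local Notation V := 'rV[R]_d.
Local Notation mu := (@lebesgue_rV R d).
Local Notation k := (eta * m / (m - 1)).
Local Notation U := (Ufun lambda eta m Psi).
Implicit Types (C : R) (y : V) (rho : V -> R).

Let mu_gt0 : (0 < mu setT)%E.
Proof. exact: lebesgue_rV_gt0. Qed.

(** The Gibbs weight, which dominates every [U C] up to a constant factor and thus carries its
    integrability. *)
Let gibbs y := expR (- Psi y / lambda).

Let gibbs_gt0 y : 0 < gibbs y. Proof. exact: expR_gt0. Qed.

Let gibbs_le1 y : gibbs y <= 1.
Proof.
by rewrite -[leRHS]expR0 ler_expR pmulr_lle0 ?invr_gt0// oppr_le0.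
Qed.

Let measurable_gibbs : measurable_fun [set: lebesgue_rV_type R d] gibbs.
Proof.
apply: measurableT_comp; first exact: measurable_expR.
apply: measurable_funM; last exact: measurable_cst.
exact: measurable_funN.
Qed.

Let gibbs_decay : exists M a : R, [/\ 0 <= M, 0 < a &
  forall y, gibbs y * enorm y `^ (d%:R + 2 + a) <= M].
Proof.
have [r [delta [r0 delta0 grow]]] := Psi_growth.
have a0 : 0 < delta / lambda by rewrite divr_gt0.
(* The summand 1 bounds the product for [|y| >= r], by the growth of [Psi]. The power of [r] bounds
   it inside, where [gibbs <= 1]. *)
exists (1 + r `^ (d%:R + 2 + delta / lambda)), (delta / lambda).
split=> // [|y]; first by rewrite addr_ge0// powR_ge0.
have s0 : 0 <= d%:R + 2 + delta / lambda by rewrite !addr_ge0// ltW.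
have [ry|/ltW yr] := leP r (enorm y).
  apply: (@le_trans _ _ 1); last by rewrite lerDl powR_ge0.
  rewrite /powR gt_eqF ?(lt_le_trans r0)// -expRD -[leRHS]expR0 ler_expR.
  rewrite mulNr addrC subr_le0 ler_pdivlMr// mulrC (le_trans _ (grow y ry))//.
  by rewrite mulrA mulrDr [lambda * (_ / _)]mulrCA divff ?gt_eqF// mulr1.
rewrite -[leLHS]add0r lerD// -[leRHS]mul1r ler_pM ?powR_ge0 ?(ltW (gibbs_gt0 y))//.
by rewrite ge0_ler_powR ?nnegrE ?enorm_ge0 ?(ltW r0).
Qed.

Lemma measurable_enorm2 :
  measurable_fun [set: lebesgue_rV_type R d] (fun y : V => enorm y ^+ 2).
Proof. by apply: measurable_funX; exact: measurable_enorm. Qed.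

Let integrable_gibbs_moment :
  mu.-integrable setT (EFin \o (fun y => enorm y ^+ 2 * gibbs y)).
Proof.
have [M [a [M0 a0 decay]]] := gibbs_decay.
have n2 y : enorm y ^+ 2 = enorm y `^ 2 by rewrite powR_mulrn// enorm_ge0.
have n2D y : enorm y ^+ 2 * enorm y `^ (d%:R + a) = enorm y `^ (d%:R + 2 + a).
  have s0 : 0 < 2 + (d%:R + a) by rewrite !ltr_wpDl.
  rewrite n2 -powRD; last by rewrite gt_eqF.
  by rewrite addrA [2 + _]addrC.
apply: (@integrable_polynomial_decay _ _ d_gt0 _ (1 + M) a a0) => [|y|y|y].
- by apply: measurable_funM; [exact: measurable_enorm2|exact: measurable_gibbs].
- by rewrite mulr_ge0 ?exprn_ge0 ?enorm_ge0 ?(ltW (gibbs_gt0 y)).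
(* For [|y| <= 1] both factors are at most 1. For [|y| >= 1] the square is below the power
   [d + 2 + a], which [decay] controls. *)
- have [y1|/ltW y1] := leP (enorm y) 1.
    rewrite -[leLHS]addr0 lerD// -[leRHS]mulr1.
    apply: ler_pM => //; rewrite ?exprn_ge0 ?enorm_ge0 ?(ltW (gibbs_gt0 y))//.
    by rewrite exprn_ile1// enorm_ge0.
  rewrite -[leLHS]add0r lerD//; apply: le_trans (decay y).
  rewrite mulrC ler_pM2l// n2 ler_powR//.
  by rewrite -addrA [2 + _]addrC addrA lerDr addr_ge0// ltW.
- rewrite -[leLHS]add0r lerD//; apply: le_trans (decay y).
  by rewrite mulrAC n2D mulrC.
Qed.

Let integrable_gibbs : mu.-integrable setT (EFin \o gibbs).
Proof.
have [M [a [M0 a0 decay]]] := gibbs_decay.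
have a2 : 0 < 2 + a by rewrite addr_gt0.
apply: (@integrable_polynomial_decay _ _ d_gt0 _ (1 + M) (2 + a) a2) => [|y|y|y].
- exact: measurable_gibbs.
- exact: ltW.
- by rewrite (le_trans (gibbs_le1 y))// lerDl.
- by rewrite addrA (le_trans (decay y))// lerDr.
Qed.

Lemma U_gt0 C y : 0 < U C y. Proof. exact: hinv_gt0. Qed.

Lemma measurable_U C : measurable_fun [set: lebesgue_rV_type R d] (U C).
Proof.
apply: measurableT_comp; first exact: measurable_hinv.
by apply: measurable_funB; [exact: measurable_cst|exact: measurable_Psi].
Qed.

Let U_le_gibbs C y : U C y <= expR ((C + k) / lambda) * gibbs y.
Proof.
apply: le_trans (hinv_ub lambda_gt0 eta_gt0 m_gt1 _) _.
by rewrite -expRD ler_expR -mulrDl addrAC.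
Qed.

Lemma U_ub C y : U C y <= expR ((C + k) / lambda).
Proof.
by apply: le_trans (U_le_gibbs C y) _; rewrite ler_piMr// expR_ge0.
Qed.

Lemma integrable_U C : mu.-integrable setT (EFin \o U C).
Proof.
apply: le_integrable_real (integrable_scale (expR ((C + k) / lambda)) integrable_gibbs).
  exact: measurable_U.
by move=> y; rewrite gtr0_norm ?U_gt0.
Qed.

Lemma integrable_U_moment C :
  mu.-integrable setT (EFin \o (fun y => enorm y ^+ 2 * U C y)).
Proof.
apply: le_integrable_real
  (integrable_scale (expR ((C + k) / lambda)) integrable_gibbs_moment).
  by apply: measurable_funM; [exact: measurable_enorm2|exact: measurable_U].
move=> y; rewrite ger0_norm; last by rewrite mulr_ge0 ?exprn_ge0 ?enorm_ge0 ?ltW ?U_gt0.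
by rewrite mulrCA ler_wpM2l ?exprn_ge0 ?enorm_ge0.
Qed.

(** * The mass of [U C] as a function of [C] *)

Definition mass C : R := \int[mu]_y U C y.

Lemma integral_U C : (\int[mu]_y (U C y)%:E = (mass C)%:E)%E.
Proof. by rewrite fineK//; exact: integrable_fin_num (integrable_U C). Qed.

Lemma mass_gt0 C : 0 < mass C.
Proof. exact: Rintegral_gt0 mu_gt0 (integrable_U C) (U_gt0 C). Qed.

Lemma mass_lt : {homo mass : C C' / C < C'}.
Proof.
move=> C C' CC'; rewrite -subr_gt0 -RintegralB//; last 2 first.
- exact: integrable_U.
- exact: integrable_U.
apply: Rintegral_gt0 => // [|y].
  exact: (integrableB measurableT (integrable_U C') (integrable_U C)).
by rewrite subr_gt0; apply: hinv_lt => //; rewrite ltrD2r.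
Qed.

Lemma le_mass_scale c C C' : (forall y, U C y <= c * U C' y) ->
  mass C <= c * mass C'.
Proof.
move=> UU; rewrite -RintegralZl//; last exact: integrable_U.
apply: le_Rintegral => //; first exact: integrable_U.
exact: integrable_scale (integrable_U C').
Qed.

(** The pointwise ratio of [U C'] to [U C] is bounded by a factor independent of [y], which passes
    to the masses. *)
Lemma mass_lipschitz C C' : C <= C' -> ln (mass C') - ln (mass C) <= (C' - C) / lambda.
Proof.
move=> CC'; rewrite -[leRHS]expRK lerBlDr -lnM ?posrE ?expR_gt0 ?mass_gt0//.
rewrite ler_ln ?posrE ?mulr_gt0 ?expR_gt0 ?mass_gt0//.
apply: le_mass_scale => y; rewrite mulrC.
have -> : C' - C = C' - Psi y - (C - Psi y) by rewrite opprB addrA subrK.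
by apply: hinv_le_expR => //; rewrite lerD2r.
Qed.

Lemma continuous_ln_mass : continuous (fun C => ln (mass C)).
Proof.
have lip C C' : `|ln (mass C) - ln (mass C')| <= `|C - C'| / lambda.
  wlog CC' : C C' / C <= C' => [H|].
    have [/H//|/ltW/H] := leP C C'.
    by rewrite distrC [`|C' - C|]distrC.
  rewrite distrC [`|C - C'|]distrC [`|C' - C|]ger0_norm ?subr_ge0// ger0_norm.
    exact: mass_lipschitz.
  rewrite subr_ge0 ler_ln ?posrE ?mass_gt0//.
  by move: CC'; rewrite le_eqVlt => /predU1P[->//|/mass_lt/ltW].
move=> C; apply/cvgrPdist_le => e e0.
near=> C'; apply: le_trans (lip _ _) _; rewrite ler_pdivrMr//.
near: C'; apply: cvgr_dist_le; first exact: cvg_id.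
by rewrite mulr_gt0.
Unshelve. all: by end_near. Qed.

Lemma mass_le1 : exists C, mass C <= 1.
Proof.
pose I := \int[mu]_y gibbs y.
have I0 : 0 < I by exact: Rintegral_gt0 mu_gt0 integrable_gibbs gibbs_gt0.
(* This [C] makes the factor [expR ((C + k) / lambda)] of [U_le_gibbs] equal to [I^-1]. *)
exists (lambda * ln I^-1 - k).
apply: (@le_trans _ _ (expR (ln I^-1) * I)); last first.
  by rewrite lnK ?posrE ?invr_gt0// mulVf// gt_eqF.
rewrite -RintegralZl//.
apply: le_Rintegral => //; first exact: integrable_U.
  exact: integrable_scale integrable_gibbs.
move=> y _; apply: le_trans (U_le_gibbs _ _) _.
by rewrite subrK mulrAC divff ?gt_eqF// mul1r.
Qed.

(* [Psi >= 0] bounds the values of [U 0], so a single shift of [C] scales all of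
   them by a prescribed factor. *)
Lemma mass_ge1 : exists C, 1 <= mass C.
Proof.
pose T := Num.max 1 (mass 0)^-1.
have T1 : 1 <= T by rewrite le_max lexx.
have T0 : 0 < T by rewrite (lt_le_trans _ T1).
have [D scale] := hinv_scale lambda_gt0 eta_gt0 m_gt1 0 T1.
exists D; apply: (@le_trans _ _ (T * mass 0)).
  by rewrite -ler_pdivrMr ?mass_gt0// mul1r le_max lexx orbT.
rewrite -ler_pdivlMl//; apply: le_mass_scale => y.
rewrite ler_pdivlMl//; apply: le_trans (scale _ _) _.
  by rewrite sub0r oppr_le0.
by rewrite /Ufun sub0r addrC.
Qed.

Lemma mass_eq1 : exists C, mass C = 1.
Proof.
have [[C1 h1] [C2 h2]] := (mass_le1, mass_ge1).
have C12 : C1 <= C2.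
  rewrite leNgt; apply/negP => /mass_lt CC.
  by have := lt_le_trans CC (le_trans h1 h2); rewrite ltxx.
have min_le_max (x z : R) : x <= 0 -> 0 <= z -> Num.min x z <= 0 <= Num.max x z.
  by move=> x0 z0; rewrite ge_min le_max x0 z0 orbT.
have [|C _ /= lnC] :=
  @IVT _ (fun C => ln (mass C)) C1 C2 0 C12 (continuous_subspaceT continuous_ln_mass).
  by apply: min_le_max; [exact: ln_le0|exact: ln_ge0].
by exists C; rewrite -[LHS]lnK ?posrE ?mass_gt0// lnC expR0.
Qed.

Lemma mass_inj : injective mass.
Proof.
move=> C C' CC'; apply/eqP; case: ltgtP => // /mass_lt.
  by rewrite CC' ltxx.
by rewrite CC' ltxx.
Qed.

(** * The functional as the integral of one energy density *)

Definition energy_density rho y : R := Psi y * rho y + energy lambda eta m (rho y).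

Lemma D2_integrable rho : D2 rho -> mu.-integrable setT (EFin \o rho).
Proof. by case=> mrho rho0 rho1 _; apply: integrable_lty => //; rewrite rho1 ltry. Qed.

Lemma D2_Rintegral rho : D2 rho -> \int[mu]_y rho y = 1.
Proof. by case=> _ _ rho1 _; rewrite /Rintegral rho1. Qed.

Lemma D2_integrable_moment rho : D2 rho ->
  mu.-integrable setT (EFin \o (fun y => enorm y ^+ 2 * rho y)).
Proof.
case=> mrho rho0 _ rho2; apply: integrable_lty rho2.
  by apply: measurable_funM; [exact: measurable_enorm2|exact: mrho].
by move=> y; rewrite mulr_ge0 ?exprn_ge0 ?enorm_ge0.
Qed.

(** A comparison density for bounding the negative part of the entropy: it is integrable, yet
    [- ln (weight y)] grows only logarithmically. *)
Let weight y := (1 + enorm y ^+ 2) `^ (- d.+1%:R).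

Let base_gt0 y : 0 < 1 + enorm y ^+ 2.
Proof. by rewrite ltr_wpDr ?exprn_ge0 ?enorm_ge0. Qed.

Let weight_gt0 y : 0 < weight y.
Proof. exact: powR_gt0. Qed.

Let weightE y : weight y = ((1 + enorm y ^+ 2) ^+ d.+1)^-1.
Proof. by rewrite /weight powRN powR_mulrn// ltW. Qed.

Let integrable_weight : mu.-integrable setT (EFin \o weight).
Proof.
apply: (@integrable_polynomial_decay _ _ d_gt0 _ 1 1 ltr01) => [|y|y|y].
- apply: (measurableT_comp (measurable_powR _)).
  apply: measurable_funD; first exact: measurable_cst.
  exact: measurable_enorm2.
- exact: ltW.
- rewrite weightE invf_le1 ?exprn_gt0//; apply: exprn_ege1.
  by rewrite lerDl exprn_ge0 ?enorm_ge0.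
- rewrite weightE natr1 powR_mulrn ?enorm_ge0// mulrC ler_pdivrMr ?exprn_gt0// mul1r.
  rewrite lerXn2r ?nnegrE ?enorm_ge0 ?(ltW (base_gt0 y))//.
  have := enorm_ge0 y; move: (enorm y) => z z0.
  (* This square gives [z <= 1 + z ^ 2]. *)
  by have := sqr_ge0 (z - 2^-1); lra.
Qed.

(* The tangent of the entropy at a polynomially decaying weight only costs a
   second moment, as [ln (1 + |y|^2) <= |y|^2]. *)
Let entropy_neg_le rho y : 0 <= rho y ->
  Num.max (- entropy lambda (rho y)) 0 <=
  lambda * (d.+1%:R * (enorm y ^+ 2 * rho y) + weight y).
Proof.
move=> rho0; rewrite ge_max; apply/andP; split; last first.
  rewrite mulr_ge0 ?addr_ge0 ?(ltW lambda_gt0) ?(ltW (weight_gt0 y))//.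
  by rewrite !mulr_ge0 ?exprn_ge0 ?enorm_ge0.
rewrite lerNl (le_trans _ (entropy_ge lambda_gt0 rho0 (weight_gt0 y)))//.
rewrite -mulrN ler_pM2l// opprD lerD2r.
rewrite /weight ln_powR mulNr mulrN lerN2.
rewrite mulrCA ler_wpM2l// mulrC ler_wpM2r//.
by apply: le_ln1Dx; rewrite (lt_le_trans _ (exprn_ge0 2 (enorm_ge0 y))) ?ltrN10.
Qed.

Let measurable_entropy_comp rho : measurable_fun [set: lebesgue_rV_type R d] rho ->
  measurable_fun [set: lebesgue_rV_type R d] (fun y => entropy lambda (rho y)).
Proof. by move=> mrho; apply: measurableT_comp mrho; exact: measurable_entropy. Qed.

Let measurable_entropy_pos rho : measurable_fun [set: lebesgue_rV_type R d] rho ->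
  measurable_fun [set: lebesgue_rV_type R d]
    (fun y => Num.max (entropy lambda (rho y)) 0).
Proof.
move=> mrho; apply: measurable_maxr; last exact: measurable_cst.
exact: measurable_entropy_comp.
Qed.

Let measurable_entropy_neg rho : measurable_fun [set: lebesgue_rV_type R d] rho ->
  measurable_fun [set: lebesgue_rV_type R d]
    (fun y => Num.max (- entropy lambda (rho y)) 0).
Proof.
move=> mrho; apply: measurable_maxr; last exact: measurable_cst.
exact: measurable_funN (measurable_entropy_comp mrho).
Qed.

Let measurable_power rho : measurable_fun [set: lebesgue_rV_type R d] rho ->
  measurable_fun [set: lebesgue_rV_type R d]
    (fun y => eta / (m - 1) * rho y `^ m).
Proof.
move=> mrho; apply: measurable_funM; first exact: measurable_cst.
exact: measurableT_comp (measurable_powR m) mrho.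
Qed.

Let eta_coef_gt0 : 0 < eta / (m - 1).
Proof. by rewrite divr_gt0// subr_gt0. Qed.

Lemma D2_integrable_entropy_neg rho : D2 rho ->
  mu.-integrable setT (EFin \o (fun y => Num.max (- entropy lambda (rho y)) 0)).
Proof.
move=> Drho; have [mrho rho0 _ _] := Drho.
apply: le_integrable_real (integrable_scale lambda
  (integrable_add (integrable_scale d.+1%:R (D2_integrable_moment Drho))
     integrable_weight)).
  exact: measurable_entropy_neg.
move=> y; rewrite ger0_norm ?le_max ?lexx ?orbT//.
exact: entropy_neg_le.
Qed.

(** The subtracted integral is finite on [D2], and the other three are nonnegative. A finite value
    of [Jfun] therefore makes each of them finite, and all four merge into one. *)
Lemma Jfun_fin rho : D2 rho -> (Jfun lambda eta m Psi rho < +oo)%E ->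
  mu.-integrable setT (EFin \o energy_density rho) /\
  (Jfun lambda eta m Psi rho = (\int[mu]_y energy_density rho y)%:E)%E.
Proof.
move=> Drho; have [mrho rho0 _ _] := Drho.
pose a y := Psi y * rho y.
pose p y := Num.max (entropy lambda (rho y)) 0.
pose n y := Num.max (- entropy lambda (rho y)) 0.
pose w y := eta / (m - 1) * rho y `^ m.
have a0 y : 0 <= a y by exact: mulr_ge0.
have p0 y : 0 <= p y by rewrite le_max lexx orbT.
have w0 y : 0 <= w y by rewrite mulr_ge0 ?powR_ge0 ?(ltW eta_coef_gt0).
have intn : mu.-integrable setT (EFin \o n) by exact: D2_integrable_entropy_neg.
have nK := fineK (integrable_fin_num measurableT intn).
rewrite /Jfun => Jlt.
have [alt plt wlt] : [/\ (\int[mu]_y (a y)%:E < +oo)%E,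
    (\int[mu]_y (p y)%:E < +oo)%E & (\int[mu]_y (w y)%:E < +oo)%E].
  have ia0 : (0 <= \int[mu]_y (a y)%:E)%E by apply: integral_ge0 => y _; rewrite lee_fin.
  have ip0 : (0 <= \int[mu]_y (p y)%:E)%E by apply: integral_ge0 => y _; rewrite lee_fin.
  have iw0 : (0 <= \int[mu]_y (w y)%:E)%E by apply: integral_ge0 => y _; rewrite lee_fin.
  move: Jlt; rewrite -[X in (_ - X)%E]nK.
  move: ia0 ip0 iw0; rewrite -/p -/w /a.
  by case: (\int[mu]_y _)%E => [x1||]//; case: (\int[mu]_y _)%E => [x2||]//;
    case: (\int[mu]_y _)%E => [x3||]//= *; split; rewrite ?ltry.
have ma : measurable_fun [set: lebesgue_rV_type R d] a.
  by apply: measurable_funM; [exact: measurable_Psi|exact: mrho].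
have inta : mu.-integrable setT (EFin \o a) by exact: integrable_lty ma a0 alt.
have intp : mu.-integrable setT (EFin \o p).
  exact: integrable_lty (measurable_entropy_pos mrho) p0 plt.
have intw : mu.-integrable setT (EFin \o w).
  exact: integrable_lty (measurable_power mrho) w0 wlt.
have intap := integrable_add inta intp.
have intapn : mu.-integrable setT (EFin \o (fun y => a y + p y - n y)).
  exact: (integrableB measurableT intap intn).
have E : energy_density rho = fun y => a y + p y - n y + w y.
  apply/funext => y; rewrite /energy_density /energy -/(a y) -/(w y).
  rewrite addrA; congr (_ + _); rewrite -addrA; congr (_ + _).
  rewrite /p /n; case: (leP 0 (entropy lambda (rho y))) => [e0|/ltW e0].
    by rewrite max_r ?subr0// oppr_le0.
  by rewrite max_l ?oppr_ge0// sub0r opprK.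
rewrite E; split; first exact: integrable_add intapn intw.
rewrite RintegralD// RintegralB// RintegralD//.
rewrite !EFinD EFinN /Rintegral !fineK//; exact: integrable_fin_num.
Qed.

(** * Minimality and uniqueness at unit mass *)

Section normalized.
Variable C : R.
Hypothesis mass_C : mass C = 1.

Lemma D2_U : D2 (U C).
Proof.
split; [exact: measurable_U|by move=> y; exact/ltW/U_gt0| |].
  by rewrite integral_U mass_C.
exact: integral_lty (integrable_U_moment C).
Qed.

Lemma Jfun_U_lty : (Jfun lambda eta m Psi (U C) < +oo)%E.
Proof.
pose b := expR ((C + k) / lambda).
have u0 y : 0 < U C y by exact: U_gt0.
have ub y : U C y <= b by exact: U_ub.
have intu := integrable_U C.
have intn := D2_integrable_entropy_neg D2_U.
have mU := measurable_U C.
have uD y : U C y `^ m = U C y `^ (m - 1) * U C y.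
  rewrite -[X in _ * X](powRr1 (ltW (u0 y))) -powRD ?subrK// gt_eqF//.
  by rewrite (lt_trans _ m_gt1).
rewrite /Jfun; apply: lte_add_pinfty; [apply: lte_add_pinfty; [apply: lte_add_pinfty|]|].
(* Since [Psi = C - h U], the product [Psi * U] is [C * U - entropy U - k * U ^ m + k * U]. It is at
   most [(|C| + k) * U] plus the negative part of the entropy. *)
- apply: integral_lty; apply: le_integrable_real
    (integrable_add (integrable_scale (`|C| + k) intu) intn).
    by apply: measurable_funM; [exact: measurable_Psi|exact: mU].
  move=> y; rewrite ger0_norm; last by rewrite mulr_ge0 ?(ltW (u0 y)).
  have : - entropy lambda (U C y) <= Num.max (- entropy lambda (U C y)) 0.
    by rewrite le_max lexx.
  have := hinvK lambda_gt0 eta_gt0 m_gt1 (C - Psi y); rewrite -/(Ufun _ _ _ _ _ _).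
  rewrite /hfun entropyE.
  have := mulr_ge0 (ltW (hfun_coef_gt0 eta_gt0 m_gt1)) (powR_ge0 (U C y) m).
  rewrite uD; move: (ler_norm C) (u0 y).
  set M := Num.max _ _; set u := U C y; set x := u `^ _; set l := ln u; set c := `|C|.
  move=> Cc u1 xu eq nM.
  have -> : Psi y = C - (lambda * l + k * (x - 1)) by rewrite eq opprB addrC subrK.
  have : C * u <= c * u by rewrite ler_pM2r.
  by move: nM xu; lra.
(* The upper bound on [U C] gives [lambda * ln U <= C + k]. *)
- apply: integral_lty.
  apply: le_integrable_real (integrable_scale (`|C + k|) intu).
    exact: measurable_entropy_pos.
  move=> y; rewrite ger0_norm ?le_max ?lexx ?orbT// ge_max mulr_ge0 ?(ltW (u0 y))//.
  rewrite andbT entropyE mulrAC ler_pM2r// (le_trans _ (ler_norm _))//.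
  rewrite mulrC -ler_pdivlMr// -[leRHS]expRK ler_ln ?posrE ?expR_gt0//; exact: ub.
- by rewrite -(fineK (integrable_fin_num measurableT intn)) -EFinN ltry.
(* Boundedness again: [U ^ m <= b ^ (m - 1) * U]. *)
- apply: integral_lty.
  apply: le_integrable_real (integrable_scale (eta / (m - 1) * b `^ (m - 1)) intu).
    exact: measurable_power.
  move=> y; rewrite ger0_norm; last by rewrite mulr_ge0 ?powR_ge0 ?(ltW eta_coef_gt0).
  rewrite -[leRHS]mulrA ler_pM2l// uD ler_pM2r//.
  by rewrite ge0_ler_powR ?nnegrE ?subr_ge0 ?(ltW m_gt1) ?(ltW (u0 y)) ?expR_ge0.
Qed.

(* The tangent of the energy at [U C] has slope [C - Psi + const], so [Psi]
   cancels and only the normalizations of the two densities remain. *)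
Let gap rho y := energy_density rho y - energy_density (U C) y
  - (C + lambda + k) * (rho y - U C y).

Let gap_gt0 rho y : 0 <= rho y -> rho y != U C y -> 0 < gap rho y.
Proof.
move=> rho0 neq.
have := energy_tangent lambda_gt0 eta_gt0 m_gt1 rho0 (U_gt0 C y) neq.
rewrite /Ufun hinvK// -/(Ufun _ _ _ _ _ _) /gap /energy_density.
by move: (energy _ _ _ (U C y)) (energy _ _ _ (rho y)) => e1 e2; lra.
Qed.

Let gap_ge0 rho y : 0 <= rho y -> 0 <= gap rho y.
Proof.
move=> rho0; have [e|neq] := eqVneq (rho y) (U C y); last exact/ltW/gap_gt0.
by rewrite /gap /energy_density e !subrr mulr0 subrr.
Qed.

Let Rintegral_gap rho : D2 rho ->
  mu.-integrable setT (EFin \o energy_density rho) ->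
  mu.-integrable setT (EFin \o gap rho) /\
  \int[mu]_y gap rho y =
    \int[mu]_y energy_density rho y - \int[mu]_y energy_density (U C) y.
Proof.
move=> Drho inte; have [intu _] := Jfun_fin D2_U Jfun_U_lty.
have inteu : mu.-integrable setT
    (EFin \o (fun y => energy_density rho y - energy_density (U C) y)).
  exact: (integrableB measurableT inte intu).
have intd : mu.-integrable setT (EFin \o (fun y => rho y - U C y)).
  exact: (integrableB measurableT (D2_integrable Drho) (integrable_U C)).
have intkd := integrable_scale (C + lambda + k) intd.
split; first exact: (integrableB measurableT inteu intkd).
rewrite RintegralB// RintegralB// RintegralZl// RintegralB//.
- have -> : \int[mu]_y U C y = 1 := mass_C.
  by rewrite (D2_Rintegral Drho) subrr mulr0 subr0.
- exact: D2_integrable.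
- exact: integrable_U.
Qed.

(** A competitor of infinite energy is no obstacle. For the others, the difference of the energies
    is the integral of [gap], which is nonnegative. *)
Lemma U_minimizer : minimizer (Jfun lambda eta m Psi) (@D2 R d) (U C).
Proof.
split=> [|rho Drho]; first exact: D2_U.
have [Jrho|] := ltP (Jfun lambda eta m Psi rho) +oo%E; last exact: le_trans (leey _).
have [inte ->] := Jfun_fin Drho Jrho.
have [_ ->] := Jfun_fin D2_U Jfun_U_lty.
have [intg Ig] := Rintegral_gap Drho inte.
rewrite lee_fin -subr_ge0 -Ig; apply: Rintegral_ge0 => y _.
by apply: gap_ge0; case: Drho.
Qed.

(** Comparison with [U C] shows that [rho] has finite energy and that the integral of [gap rho] is
    at most 0. Hence [gap rho] vanishes almost everywhere, while it is positive wherever [rho] and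
    [U C] differ. *)
Lemma minimizer_ae_U rho : minimizer (Jfun lambda eta m Psi) (@D2 R d) rho ->
  {ae mu, forall y, rho y = U C y}.
Proof.
move=> [Drho /(_ _ D2_U) JJ]; have [_ rho0 _ _] := Drho.
have [inte E] := Jfun_fin Drho (le_lt_trans JJ Jfun_U_lty).
have [_ EU] := Jfun_fin D2_U Jfun_U_lty.
have [intg Ig] := Rintegral_gap Drho inte.
have : {ae mu, forall y, gap rho y = 0}.
  apply: Rintegral_ae0 => // [y|]; first exact: gap_ge0.
  rewrite Ig subr_le0 -lee_fin -E -EU; exact: JJ.
apply: (filterS (F := almost_everywhere mu)) => y g0.
apply/eqP; apply: contraT => /(gap_gt0 (rho0 y)).
by rewrite g0 ltxx.
Qed.

End normalized.
End stationary_density.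

Theorem theorem6p1 (R : realType) (d : nat) (hd : (0 < d)%N)
  (lambda eta m : R) (hlambda : 0 < lambda) (heta : 0 < eta) (hm : 1 < m)
  (Psi : 'rV[R]_d -> R) (hPsi0 : forall y, 0 <= Psi y) (hPsiW : W11loc Psi)
  (hgrowth : exists r delta : R, [/\ 0 < r, 0 < delta &
     forall y : 'rV[R]_d, r <= enorm y ->
       (lambda * (d%:R + 2) + delta) * ln (enorm y) <= Psi y])
  (hgrad : exists G : 'rV[R]_d -> 'rV[R]_d, weak_gradient Psi G /\
     exists2 K : R, 0 < K &
       {ae @lebesgue_rV R d, forall y, enorm (G y) <= K * (1 + enorm y)}) :
  exists Cstar : R,
    unique (fun C : R =>
      (\int[@lebesgue_rV R d]_y (Ufun lambda eta m Psi C y)%:E = 1)%E) Cstar /\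
    let rho_inf := Ufun lambda eta m Psi Cstar in
    minimizer (Jfun lambda eta m Psi) (@D2 R d) rho_inf /\
    forall rho : 'rV[R]_d -> R,
      minimizer (Jfun lambda eta m Psi) (@D2 R d) rho ->
      {ae @lebesgue_rV R d, forall y, rho y = rho_inf y}.
Proof.
have mPsi := hPsiW.1.1.
have [C C1] := mass_eq1 hd hlambda heta hm hPsi0 mPsi hgrowth.
have intU C' := integral_U hd hlambda heta hm hPsi0 mPsi hgrowth C'.
exists C; split.
  split=> [|C' C'1]; first by rewrite intU C1.
  apply: (mass_inj hd hlambda heta hm hPsi0 mPsi hgrowth).
  by move: C'1; rewrite intU C1 => -[].
split; first exact: U_minimizer.
by move=> rho; exact: minimizer_ae_U.
Qed.
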